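(* The category of external actions in $\mathcal{M}$ is equivalent to the category of Schreier split epimorphisms in $\mathcal{M}$, where $\mathcal{M}$ is the category of cancellative conjugation monoids.
   Context: A conjugation monoid $(M,+,0,\overline{(\;)})$ is a monoid (written additively but not assumed commutative) equipped with a unary operation $\overline{(\;)}\colon M\to M$ satisfying, for all $x,y$: $\overline{x}+x=x+\overline{x}$; $x+\overline{y}+y=y+\overline{y}+x$; $\overline{(x+y)}=\overline{y}+\overline{x}$. It is cancellative if its underlying monoid is (left and right) cancellative. The category $\mathcal{M}$ has cancellative conjugation monoids as objects and monoid homomorphisms preserving the conjugation as morphisms. A Schreier split epimorphism in $\mathcal{M}$ is a pair of morphisms $f\colon A\to B$, $r\colon B\to A$ in $\mathcal{M}$ with $fr=1_B$ such that, $k\colon X\to A$ being the kernel of $f$, there exists a unique set-theoretical map $q\colon A\to X$ with $a=kq(a)+rf(a)$ for every $a\in A$. Morphisms of Schreier split epimorphisms $(f,r)\to(f',r')$ are pairs of morphisms $A\to A'$, $B\to B'$ in $\mathcal{M}$ commuting with $f,f'$ and with $r,r'$. An external action in $\mathcal{M}$ consists of objects $B$, $X$ of $\mathcal{M}$ and a monoid homomorphism $\varphi\colon B\to \mathrm{End}(X)$ from the underlying monoid of $B$ to the monoid of endomorphisms of the underlying monoid of $X$, written $\varphi(b)(x)=b\cdot x$, satisfying the following three conditions for all $b,b_1,b_2\in B$ and $x,x_1,x_2\in X$: $$\overline{b}\cdot(\overline{x}+x)=x+(b+\overline{b})\cdot\overline{x},$$ $$x_1+(b_1+\overline{b_1})\cdot(\overline{x_1}+x_2)=x_2+(b_2+\overline{b_1})\cdot(\overline{x_1}+x_1),$$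 $$(\overline{b_2}+\overline{b_1})\cdot(\overline{b_1\cdot x_2})=\overline{b_2}\cdot\overline{x_2}.$$ Morphisms of external actions $(B,X,\varphi)\to(B',X',\varphi')$ are pairs of morphisms $v\colon B\to B'$, $u\colon X\to X'$ in $\mathcal{M}$ with $u(b\cdot x)=v(b)\cdot u(x)$ for all $b\in B$, $x\in X$. *)

(* Defs.v *)
From HB Require Import structures.
From mathcomp Require Import all_boot.
From mathcomp Require Import boolp.

Set Implicit Arguments.
Unset Strict Implicit.
Unset Printing Implicit Defensive.

Local Open Scope group_scope.

(** * Categories *)

Record category := Category {
  obj :> Type;
  hom : obj -> obj -> Type;
  idm : forall a, hom a a;
  comp : forall a b c, hom b c -> hom a b -> hom a c;
  comp_idl : forall a b (f : hom a b), comp (idm b) f = f;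
  comp_idr : forall a b (f : hom a b), comp f (idm a) = f;
  comp_assoc : forall a b c d (h : hom c d) (g : hom b c) (f : hom a b),
    comp h (comp g f) = comp (comp h g) f }.

Arguments hom {C} a b : rename.
Arguments idm {C} a : rename.
Arguments comp {C a b c} g f : rename.

Record functor (C D : category) := Functor {
  fobj :> C -> D;
  fmap : forall a b : C, hom a b -> hom (fobj a) (fobj b);
  fmap_id : forall a : C, fmap (idm a) = idm (fobj a);
  fmap_comp : forall (a b c : C) (g : hom b c) (f : hom a b),
    fmap (comp g f) = comp (fmap g) (fmap f) }.

Definition id_functor (C : category) : functor C C :=
  @Functor C C id (fun _ _ f => f) (fun _ => erefl) (fun _ _ _ _ _ => erefl).

Section FunctorComposition.
Variables (C D E : category) (G : functor D E) (F : functor C D).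

Let GF_map (a b : C) (f : hom a b) : hom (G (F a)) (G (F b)) :=
  fmap G (fmap F f).

Fact comp_functor_id (a : C) : GF_map (idm a) = idm (G (F a)).
Proof. by rewrite /GF_map !fmap_id. Qed.

Fact comp_functor_comp (a b c : C) (g : hom b c) (f : hom a b) :
  GF_map (comp g f) = comp (GF_map g) (GF_map f).
Proof. by rewrite /GF_map !fmap_comp. Qed.

Definition comp_functor : functor C E :=
  @Functor C E (fun a => G (F a)) GF_map comp_functor_id comp_functor_comp.

End FunctorComposition.

Record nat_trans (C D : category) (F G : functor C D) := NatTrans {
  component :> forall a : C, hom (F a) (G a);
  naturality : forall (a b : C) (f : hom a b),
    comp (component b) (fmap F f) = comp (fmap G f) (component a) }.

Definition is_iso (C : category) (a b : C) (f : hom a b) : Prop :=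
  exists g : hom b a, comp g f = idm a /\ comp f g = idm b.

Definition nat_isomorphic (C D : category) (F G : functor C D) : Prop :=
  exists eta : nat_trans F G, forall a : C, is_iso (eta a).

Definition equivalent_categories (C D : category) : Prop :=
  exists (F : functor C D) (G : functor D C),
    nat_isomorphic (comp_functor G F) (id_functor C) /\
    nat_isomorphic (comp_functor F G) (id_functor D).

(** * Conjugation monoids *)

(* [monoidType] is multiplicative (its additive counterpart [nmodType] is
   commutative): [x * y] and [1] stand for the sum and the zero of a
   conjugation monoid. The [choiceType] structure that [monoidType] carries is
   not seen by morphisms and, classically, exists on every type. *)
HB.mixin Record Monoid_isConjMonoid M of Monoid M := {
  bar : M -> M;
  mul_barC : forall x : M, bar x * x = x * bar x;
  mul_barCA : forall x y : M, x * bar y * y = y * bar y * x;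
  barM : forall x y : M, bar (x * y) = bar y * bar x }.

#[short(type="conjMonoidType")]
HB.structure Definition ConjMonoid := {M of Monoid_isConjMonoid M & Monoid M}.

HB.mixin Record Monoid_isCancellative M of Monoid M := {
  cmulgI : @right_injective M M M mul;
  cmulIg : @left_injective M M M mul }.

#[short(type="cancelConjMonoidType")]
HB.structure Definition CancelConjMonoid :=
  {M of ConjMonoid M & Monoid_isCancellative M}.

HB.mixin Record isConjMorphism (M N : conjMonoidType) (f : M -> N) := {
  conj_morph_bar : {morph f : x / bar x >-> bar x} }.

#[short(type="conjMorphism")]
HB.structure Definition ConjMorphism (M N : conjMonoidType) :=
  {f of @isConjMorphism M N f & @UMagmaMorphism M N f}.

Lemma conjMorphism_ext (M N : conjMonoidType) (f g : conjMorphism M N) :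
  f =1 g -> f = g.
Proof.
case: f g => [f [[f1] [f2] [f3]]] [g [[g1] [g2] [g3]]] /= /funext efg.
move: f1 f2 f3 g1 g2 g3; rewrite efg => f1 f2 f3 g1 g2 g3.
by rewrite (Prop_irrelevance f1 g1) (Prop_irrelevance f2 g2)
           (Prop_irrelevance f3 g3).
Qed.

Section ConjMorphismComposition.
Variables M N P : conjMonoidType.

HB.instance Definition _ :=
  isConjMorphism.Build M M idfun (fun _ => erefl).

Variables (g : conjMorphism N P) (f : conjMorphism M N).

Fact comp_conj_morph_bar : {morph (g \o f) : x / bar x >-> bar x}.
Proof. by move=> x /=; rewrite !conj_morph_bar. Qed.

HB.instance Definition _ :=
  isConjMorphism.Build M P (g \o f) comp_conj_morph_bar.

Definition conj_id : conjMorphism M M := idfun.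
Definition conj_comp : conjMorphism M P := g \o f.

End ConjMorphismComposition.

Section CancelConjMonoidCategory.
Variables M N P Q : cancelConjMonoidType.

Fact conj_comp_idl (f : conjMorphism M N) : conj_comp (conj_id N) f = f.
Proof. exact: conjMorphism_ext. Qed.

Fact conj_comp_idr (f : conjMorphism M N) : conj_comp f (conj_id M) = f.
Proof. exact: conjMorphism_ext. Qed.

Fact conj_compA (h : conjMorphism P Q) (g : conjMorphism N P)
    (f : conjMorphism M N) :
  conj_comp h (conj_comp g f) = conj_comp (conj_comp h g) f.
Proof. exact: conjMorphism_ext. Qed.

End CancelConjMonoidCategory.

Definition CCM : category :=
  @Category cancelConjMonoidType (fun M N => conjMorphism M N)
    (fun M => conj_id M) (fun M N P g f => conj_comp g f)
    conj_comp_idl conj_comp_idr conj_compA.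

Lemma bar1 (M : cancelConjMonoidType) : bar (1 : M) = 1.
Proof. by apply: (@cmulgI M (bar 1)); rewrite -barM !mulg1. Qed.

(** * Kernels *)

Section Kernel.
Variables (A B : cancelConjMonoidType) (f : conjMorphism A B).

Definition ker_pred : {pred A} := [pred a | f a == 1].

Record kernel := Kernel { ker_val : A; ker_valP : ker_val \in ker_pred }.

HB.instance Definition _ := [isSub for ker_val].
HB.instance Definition _ := [Choice of kernel by <:].

Fact ker_closed : monoid_closed ker_pred.
Proof.
split=> [|a b]; rewrite !inE ?gmulf1 //.
by move=> /eqP fa /eqP fb; rewrite gmulfM /= fa fb mulg1.
Qed.

HB.instance Definition _ :=
  SubChoice_isSubMonoid.Build A ker_pred kernel ker_closed.

Fact ker_bar_closed (a : A) : a \in ker_pred -> bar a \in ker_pred.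
Proof. by rewrite !inE => /eqP fa; rewrite conj_morph_bar fa bar1. Qed.

Definition ker_bar (x : kernel) : kernel := Kernel (ker_bar_closed (ker_valP x)).

Fact ker_mul_barC (x : kernel) : ker_bar x * x = x * ker_bar x.
Proof. by apply: val_inj; rewrite !valM /= mul_barC. Qed.

Fact ker_mul_barCA (x y : kernel) : x * ker_bar y * y = y * ker_bar y * x.
Proof. by apply: val_inj; rewrite !valM /= mul_barCA. Qed.

Fact ker_barM (x y : kernel) : ker_bar (x * y) = ker_bar y * ker_bar x.
Proof. by apply: val_inj; rewrite !valM /= barM. Qed.

HB.instance Definition _ :=
  Monoid_isConjMonoid.Build kernel ker_mul_barC ker_mul_barCA ker_barM.

Fact ker_mulgI : @right_injective kernel kernel kernel mul.
Proof.
move=> x y z /(congr1 val); rewrite !valM => /cmulgI; exact: val_inj.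
Qed.

Fact ker_mulIg : @left_injective kernel kernel kernel mul.
Proof.
move=> x y z /(congr1 val); rewrite !valM => /cmulIg; exact: val_inj.
Qed.

HB.instance Definition _ :=
  Monoid_isCancellative.Build kernel ker_mulgI ker_mulIg.

HB.instance Definition _ :=
  isMultiplicative.Build kernel A ker_val (@valM A ker_pred kernel).
HB.instance Definition _ :=
  Multiplicative_isUMagmaMorphism.Build kernel A ker_val
    (@val1 A ker_pred kernel).
HB.instance Definition _ :=
  isConjMorphism.Build kernel A ker_val (fun _ => erefl).

Definition ker_mor : conjMorphism kernel A := ker_val.

Lemma ker_mor_universal (Y : cancelConjMonoidType) (h : conjMorphism Y A) :
    (forall y, f (h y) = 1) ->
  exists! h' : conjMorphism Y kernel, conj_comp ker_mor h' = h.
Proof.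
move=> fh; have kerh y : h y \in ker_pred by rewrite inE; apply/eqP.
pose h0 y := Kernel (kerh y).
have h0M : {morph h0 : x y / x * y}.
  by move=> x y; apply: val_inj; rewrite valM /= gmulfM.
have h01 : h0 1 = 1 by apply: val_inj; rewrite val1 /= gmulf1.
have h0b : {morph h0 : x / bar x >-> bar x}.
  by move=> x; apply: val_inj; rewrite /= conj_morph_bar.
pose mM := isMultiplicative.Build Y kernel h0 h0M.
pose m1 := Multiplicative_isUMagmaMorphism.Build Y kernel h0 h01.
pose mb := isConjMorphism.Build Y kernel h0 h0b.
pose h' : conjMorphism Y kernel := HB.pack h0 mM m1 mb.
exists h'; split=> [|g gh]; first exact: conjMorphism_ext.
apply: conjMorphism_ext => y; apply: val_inj => /=.
by rewrite -gh.
Qed.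

End Kernel.

(** * Schreier split epimorphisms *)

Record schreier := Schreier {
  sch_dom : cancelConjMonoidType;
  sch_cod : cancelConjMonoidType;
  sch_epi : conjMorphism sch_dom sch_cod;
  sch_sec : conjMorphism sch_cod sch_dom;
  sch_epiK : conj_comp sch_epi sch_sec = conj_id sch_cod;
  sch_retraction : exists! q : sch_dom -> kernel sch_epi,
    forall a, a = ker_mor sch_epi (q a) * sch_sec (sch_epi a) }.

Record schreier_mor (S T : schreier) := SchreierMor {
  sch_mor_dom : conjMorphism (sch_dom S) (sch_dom T);
  sch_mor_cod : conjMorphism (sch_cod S) (sch_cod T);
  sch_mor_epi :
    conj_comp (sch_epi T) sch_mor_dom = conj_comp sch_mor_cod (sch_epi S);
  sch_mor_sec :
    conj_comp sch_mor_dom (sch_sec S) = conj_comp (sch_sec T) sch_mor_cod }.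

Lemma schreier_mor_ext (S T : schreier) (h k : schreier_mor S T) :
  sch_mor_dom h = sch_mor_dom k -> sch_mor_cod h = sch_mor_cod k -> h = k.
Proof.
case: h k => [h1 h2 h3 h4] [k1 k2 k3 k4] /= e1 e2; subst k1 k2.
by rewrite (Prop_irrelevance h3 k3) (Prop_irrelevance h4 k4).
Qed.

Section SchreierCategory.
Variables S T U : schreier.

Definition schreier_id : schreier_mor S S :=
  @SchreierMor S S (conj_id (sch_dom S)) (conj_id (sch_cod S))
    (etrans (conj_comp_idr _) (esym (conj_comp_idl _)))
    (etrans (conj_comp_idl _) (esym (conj_comp_idr _))).

Variables (k : schreier_mor T U) (h : schreier_mor S T).

Fact schreier_comp_epi :
  conj_comp (sch_epi U) (conj_comp (sch_mor_dom k) (sch_mor_dom h)) =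
  conj_comp (conj_comp (sch_mor_cod k) (sch_mor_cod h)) (sch_epi S).
Proof. by rewrite conj_compA sch_mor_epi -!conj_compA sch_mor_epi. Qed.

Fact schreier_comp_sec :
  conj_comp (conj_comp (sch_mor_dom k) (sch_mor_dom h)) (sch_sec S) =
  conj_comp (sch_sec U) (conj_comp (sch_mor_cod k) (sch_mor_cod h)).
Proof. by rewrite -conj_compA sch_mor_sec !conj_compA sch_mor_sec. Qed.

Definition schreier_comp : schreier_mor S U :=
  SchreierMor schreier_comp_epi schreier_comp_sec.

End SchreierCategory.

Fact schreier_comp_idl (S T : schreier) (h : schreier_mor S T) :
  schreier_comp (schreier_id T) h = h.
Proof. by apply: schreier_mor_ext; exact: conj_comp_idl. Qed.

Fact schreier_comp_idr (S T : schreier) (h : schreier_mor S T) :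
  schreier_comp h (schreier_id S) = h.
Proof. by apply: schreier_mor_ext; exact: conj_comp_idr. Qed.

Fact schreier_compA (S T U V : schreier) (l : schreier_mor U V)
    (k : schreier_mor T U) (h : schreier_mor S T) :
  schreier_comp l (schreier_comp k h) = schreier_comp (schreier_comp l k) h.
Proof. by apply: schreier_mor_ext; exact: conj_compA. Qed.

Definition SchreierSplitEpi : category :=
  @Category schreier schreier_mor schreier_id schreier_comp
    schreier_comp_idl schreier_comp_idr schreier_compA.

(** * External actions *)

(* The monoid of monoid endomorphisms of [X], under composition. Only its unital
   magma structure is declared: that is all [UMagmaMorphism.type B (End X)],
   the type of monoid homomorphisms from [B], refers to ([monoidType] would
   moreover require a choice operator). *)
Definition End (X : monoidType) := UMagmaMorphism.type X X.

Section Endomorphisms.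
Variable X : monoidType.

Definition End_one : End X := idfun.
Definition End_mul (g h : End X) : End X := (g : UMagmaMorphism.type X X) \o h.

HB.instance Definition _ := hasMul.Build (End X) End_mul.
HB.instance Definition _ := hasOne.Build (End X) End_one.

End Endomorphisms.

Definition act (B X : monoidType) (phi : UMagmaMorphism.type B (End X))
    (b : B) : X -> X :=
  (phi b : UMagmaMorphism.type X X).

Record external_action := ExternalAction {
  ea_act : cancelConjMonoidType;
  ea_obj : cancelConjMonoidType;
  ea_phi : UMagmaMorphism.type ea_act (End ea_obj);
  ea_barC : forall (b : ea_act) (x : ea_obj),
    act ea_phi (bar b) (bar x * x) = x * act ea_phi (b * bar b) (bar x);
  ea_barCA : forall (b1 b2 : ea_act) (x1 x2 : ea_obj),
    x1 * act ea_phi (b1 * bar b1) (bar x1 * x2) =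
    x2 * act ea_phi (b2 * bar b1) (bar x1 * x1);
  ea_barM : forall (b1 b2 : ea_act) (x2 : ea_obj),
    act ea_phi (bar b2 * bar b1) (bar (act ea_phi b1 x2)) =
    act ea_phi (bar b2) (bar x2) }.

Record action_mor (P Q : external_action) := ActionMor {
  act_mor_act : conjMorphism (ea_act P) (ea_act Q);
  act_mor_obj : conjMorphism (ea_obj P) (ea_obj Q);
  act_mor_equivariant : forall (b : ea_act P) (x : ea_obj P),
    act_mor_obj (act (ea_phi P) b x) =
    act (ea_phi Q) (act_mor_act b) (act_mor_obj x) }.

Lemma action_mor_ext (P Q : external_action) (h k : action_mor P Q) :
  act_mor_act h = act_mor_act k -> act_mor_obj h = act_mor_obj k -> h = k.
Proof.
case: h k => [h1 h2 h3] [k1 k2 k3] /= e1 e2; subst k1 k2.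
by rewrite (Prop_irrelevance h3 k3).
Qed.

Definition action_id (P : external_action) : action_mor P P :=
  @ActionMor P P (conj_id (ea_act P)) (conj_id (ea_obj P))
    (fun _ _ => erefl).

Section ActionComposition.
Variables (P Q R : external_action) (k : action_mor Q R) (h : action_mor P Q).

Fact action_comp_equivariant (b : ea_act P) (x : ea_obj P) :
  conj_comp (act_mor_obj k) (act_mor_obj h) (act (ea_phi P) b x) =
  act (ea_phi R) (conj_comp (act_mor_act k) (act_mor_act h) b)
    (conj_comp (act_mor_obj k) (act_mor_obj h) x).
Proof. by rewrite /= !act_mor_equivariant. Qed.

Definition action_comp : action_mor P R := ActionMor action_comp_equivariant.

End ActionComposition.

Fact action_comp_idl (P Q : external_action) (h : action_mor P Q) :
  action_comp (action_id Q) h = h.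
Proof. by apply: action_mor_ext; exact: conj_comp_idl. Qed.

Fact action_comp_idr (P Q : external_action) (h : action_mor P Q) :
  action_comp h (action_id P) = h.
Proof. by apply: action_mor_ext; exact: conj_comp_idr. Qed.

Fact action_compA (P Q R S : external_action) (l : action_mor R S)
    (k : action_mor Q R) (h : action_mor P Q) :
  action_comp l (action_comp k h) = action_comp (action_comp l k) h.
Proof. by apply: action_mor_ext; exact: conj_compA. Qed.

Definition ExternalActions : category :=
  @Category external_action action_mor action_id action_comp
    action_comp_idl action_comp_idr action_compA.

(* Main.v *)
From HB Require Import structures.
From mathcomp Require Import all_boot.
From mathcomp Require Import boolp.
Require Import Defs.

Set Implicit Arguments.
Unset Strict Implicit.
Unset Printing Implicit Defensive.

Local Open Scope group_scope.

(** As for groups, the two functors are the semidirect product, and the kernel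
    with the action by which the section moves past it.

    In a Schreier split epimorphism [(f, r)] on [A] every element is uniquely
    [k x * r b], with [x] in the kernel and [b] in the codomain, and
    [b . x := q (r b * k x)] is the only element with
    [k (b . x) * r b = r b * k x]. Rewriting with this commutation rule gives
    normal forms ([sch_norm_mul], [sch_norm_bar])
<<
      (k x * r b) * (k y * r c) = k (x * b . y) * r (b * c)
      bar (k x * r b) = k (bar b . bar x) * r (bar b),
>>
    that is, the operations of [A] are those of the semidirect product. The
    axioms of external actions are then exactly what the axioms of conjugation
    monoids say about the kernel components of these normal forms. Hence
    the semidirect product of an external action is a conjugation monoid, and
    the action on the kernel of a Schreier split epimorphism is an external
    action ([sch_action]).

    Cancellativity of the semidirect product is not a formal consequence of
    that of the factors: left cancellation needs each [b . _] to be injective.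
    The second axiom of external actions provides it, since it forces [bar b] to
    act as an inverse of [b] ([act_barK]).

    Both composite functors are isomorphic to the identity: the kernel of a
    semidirect product consists of the pairs [(x, 1)], hence is [X] itself
    ([sd_proj_mor]), and [(x, b) |-> k x * r b] is an isomorphism from the
    semidirect product onto [A] ([sch_gather]). In each of the three categories
    involved, a morphism with bijective components is an isomorphism, which
    reduces both claims to bijectivity. *)

(** * Morphisms and isomorphisms *)

Lemma umagma_morphism_ext (G H : baseUMagmaType)
    (g h : UMagmaMorphism.type G H) : g =1 h -> g = h.
Proof.
case: g h => [g [[g1] [g2]]] [h [[h1] [h2]]] /= /funext egh.
move: g1 g2 h1 h2; rewrite egh => g1 g2 h1 h2.
by rewrite (Prop_irrelevance g1 h1) (Prop_irrelevance g2 h2).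
Qed.

Section ConjMorphismOfMorphs.
Variables (M : conjMonoidType) (N : cancelConjMonoidType) (f : M -> N).
Hypotheses (fM : {morph f : x y / x * y})
  (fb : {morph f : x / bar x >-> bar x}).

(** [f 1] is idempotent, and a cancellative monoid has no idempotent but [1]. *)
Lemma cancel_morph1 : f 1 = 1.
Proof. by apply: (@cmulgI N (f 1)); rewrite -fM !mulg1. Qed.

Definition conj_morphism_of_morphs : conjMorphism M N :=
  HB.pack f (isMultiplicative.Build M N f fM)
    (Multiplicative_isUMagmaMorphism.Build M N f cancel_morph1)
    (isConjMorphism.Build M N f fb).

End ConjMorphismOfMorphs.

Lemma bijective_conj_iso (M N : cancelConjMonoidType) (f : conjMorphism M N) :
  bijective f -> @is_iso CCM M N f.
Proof.
case=> g fK gK.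
have gM : {morph g : x y / x * y}.
  by move=> x y; apply: (can_inj fK); rewrite gmulfM /= !gK.
have gb : {morph g : x / bar x >-> bar x}.
  by move=> x; apply: (can_inj fK); rewrite conj_morph_bar !gK.
exists (conj_morphism_of_morphs gM gb).
by split; apply: conjMorphism_ext.
Qed.

(** Commutation of the componentwise inverses with the epimorphisms and the
    sections is obtained by conjugating the squares of [h] by these inverses. *)
Lemma schreier_iso (S T : SchreierSplitEpi) (h : hom S T) :
    bijective (sch_mor_dom h) -> bijective (sch_mor_cod h) -> is_iso h.
Proof.
move=> /bijective_conj_iso [g1 [/= g1K hK1]] /bijective_conj_iso [g2 [/= g2K hK2]].
have ge : conj_comp (sch_epi S) g1 = conj_comp g2 (sch_epi T).
  rewrite -(conj_comp_idl (conj_comp (sch_epi S) g1)) -g2K -conj_compA.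
  by rewrite (conj_compA _ _ g1) -sch_mor_epi -conj_compA hK1 conj_comp_idr.
have gs : conj_comp g1 (sch_sec T) = conj_comp (sch_sec S) g2.
  rewrite -(conj_comp_idr (conj_comp g1 (sch_sec T))) -hK2 -conj_compA.
  by rewrite (conj_compA (sch_sec T)) -sch_mor_sec !conj_compA g1K conj_comp_idl.
exists (SchreierMor ge gs).
by split; apply: schreier_mor_ext.
Qed.

Lemma action_iso (P Q : ExternalActions) (h : hom P Q) :
    bijective (act_mor_act h) -> bijective (act_mor_obj h) -> is_iso h.
Proof.
move=> /bijective_conj_iso [g1 [/= g1K hK1]] /bijective_conj_iso [g2 [/= g2K hK2]].
have g1hK b : act_mor_act h (g1 b) = b by rewrite -[RHS]/(conj_id _ b) -hK1.
have g2hK x : act_mor_obj h (g2 x) = x by rewrite -[RHS]/(conj_id _ x) -hK2.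
have hg2K x : g2 (act_mor_obj h x) = x by rewrite -[RHS]/(conj_id _ x) -g2K.
have ge b x : g2 (act (ea_phi Q) b x) = act (ea_phi P) (g1 b) (g2 x).
  by rewrite -[RHS]hg2K act_mor_equivariant g1hK g2hK.
exists (ActionMor ge).
by split; apply: action_mor_ext.
Qed.

(** * The semidirect product of an external action *)

Section ActTheory.
Variables (B X : monoidType) (phi : UMagmaMorphism.type B (End X)).

Lemma act1 x : act phi 1 x = x.
Proof. by rewrite /act gmulf1. Qed.

Lemma actM b c x : act phi (b * c) x = act phi b (act phi c x).
Proof. by rewrite /act gmulfM. Qed.

Lemma act_mulg b : {morph act phi b : x y / x * y}.
Proof. by move=> x y; rewrite /act gmulfM. Qed.

Lemma act_one b : act phi b 1 = 1.
Proof. by rewrite /act gmulf1. Qed.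

End ActTheory.

Section Semidirect.
Variable P : external_action.
Local Notation B := (ea_act P).
Local Notation X := (ea_obj P).
Local Notation act := (act (ea_phi P)).

Record semidirect := Semidirect { sd_obj : X; sd_act : B }.

Let to_pair (a : semidirect) := (sd_obj a, sd_act a).
Let of_pair (p : X * B) := Semidirect p.1 p.2.
Let to_pairK : cancel to_pair of_pair. Proof. by case. Qed.
HB.instance Definition _ := Choice.copy semidirect (can_type to_pairK).

Definition sd_mul (a c : semidirect) :=
  Semidirect (sd_obj a * act (sd_act a) (sd_obj c)) (sd_act a * sd_act c).

Fact sd_mulA : associative sd_mul.
Proof. by move=> [x b] [y c] [z d]; rewrite /sd_mul /= act_mulg actM !mulgA. Qed.

Fact sd_mul1 : left_id (Semidirect 1 1) sd_mul.
Proof. by move=> [x b]; rewrite /sd_mul /= act1 !mul1g. Qed.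

Fact sd_mulr1 : right_id (Semidirect 1 1) sd_mul.
Proof. by move=> [x b]; rewrite /sd_mul /= act_one !mulg1. Qed.

HB.instance Definition _ := isMonoid.Build semidirect sd_mulA sd_mul1 sd_mulr1.

Lemma sd_mulE x b y c :
  Semidirect x b * Semidirect y c = Semidirect (x * act b y) (b * c).
Proof. by []. Qed.

(** Since [(x, b) = (x, 1) * (1, b)], the anti-morphism law forces the
    conjugate to be [(1, bar b) * (bar x, 1)] once both inclusions preserve
    conjugation. *)
Definition sd_bar (a : semidirect) :=
  Semidirect (act (bar (sd_act a)) (bar (sd_obj a))) (bar (sd_act a)).

Fact sd_mul_barC a : sd_bar a * a = a * sd_bar a.
Proof.
case: a => x b; rewrite !sd_mulE /= -act_mulg ea_barC mul_barC.
by rewrite -actM.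
Qed.

Fact sd_mul_barCA a c : a * sd_bar c * c = c * sd_bar c * a.
Proof.
case: a c => [x2 b2] [x1 b1]; rewrite !sd_mulE /= mul_barCA -!actM -!mulgA.
by rewrite -!act_mulg -ea_barCA.
Qed.

Fact sd_barM a c : sd_bar (a * c) = sd_bar c * sd_bar a.
Proof.
case: a c => [x1 b1] [x2 b2]; rewrite /sd_bar !sd_mulE /= !barM act_mulg.
by rewrite ea_barM actM.
Qed.

HB.instance Definition _ :=
  Monoid_isConjMonoid.Build semidirect sd_mul_barC sd_mul_barCA sd_barM.

(** Taking [x1 = 1] in the second axiom of external actions leaves
    [act (b * bar b) x = x], and [b] commutes with [bar b]. *)
Lemma act_barK b : cancel (act b) (act (bar b)).
Proof.
move=> x; rewrite -actM mul_barC.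
by have := ea_barCA b b 1 x; rewrite bar1 !mul1g act_one mulg1.
Qed.

Fact sd_mulgI : @right_injective semidirect semidirect semidirect mul.
Proof.
move=> [x b] [y c] [z d]; rewrite !sd_mulE => -[/cmulgI].
by move=> /(can_inj (act_barK b)) -> /cmulgI ->.
Qed.

Fact sd_mulIg : @left_injective semidirect semidirect semidirect mul.
Proof.
move=> [x b] [y c] [z d]; rewrite !sd_mulE => -[+ /cmulIg eq_cd].
by rewrite eq_cd => /cmulIg ->.
Qed.

HB.instance Definition _ :=
  Monoid_isCancellative.Build semidirect sd_mulgI sd_mulIg.

Definition sd_epi : conjMorphism semidirect B :=
  @conj_morphism_of_morphs semidirect B sd_act (fun _ _ => erefl)
    (fun _ => erefl).

Fact sd_secM : {morph Semidirect 1 : b c / b * c}.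
Proof. by move=> b c; rewrite sd_mulE act_one mulg1. Qed.

Fact sd_sec_bar : {morph Semidirect 1 : b / bar b >-> bar b}.
Proof. by move=> b; rewrite /bar /= /sd_bar /= bar1 act_one. Qed.

Definition sd_sec : conjMorphism B semidirect :=
  conj_morphism_of_morphs sd_secM sd_sec_bar.

Fact sd_epiK : conj_comp sd_epi sd_sec = conj_id B.
Proof. exact: conjMorphism_ext. Qed.

Fact sd_ker_subproof x : Semidirect x 1 \in ker_pred sd_epi.
Proof. by rewrite inE. Qed.

Definition sd_ker (x : X) : kernel sd_epi := Kernel (sd_ker_subproof x).

Lemma sd_decomp a : a = Semidirect (sd_obj a) 1 * Semidirect 1 (sd_act a).
Proof. by case: a => x b; rewrite sd_mulE act1 mulg1 mul1g. Qed.

Fact sd_retraction : exists! q : semidirect -> kernel sd_epi,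
  forall a, a = ker_mor sd_epi (q a) * sd_sec (sd_epi a).
Proof.
exists (sd_ker \o sd_obj); split=> [|q qP]; first exact: sd_decomp.
apply: funext => a; apply: val_inj => /=.
by apply: (@cmulIg _ (sd_sec (sd_epi a))); rewrite /= -sd_decomp.
Qed.

Definition sd_schreier : schreier := Schreier sd_epiK sd_retraction.

End Semidirect.

(** * The external action of a Schreier split epimorphism *)

Section SchreierAction.
Variable S : schreier.
Local Notation f := (sch_epi S).
Local Notation r := (sch_sec S).
Local Notation X := (kernel f).
Local Notation k := (@ker_val _ _ f).

Lemma sch_epi_sec b : f (r b) = b.
Proof. by rewrite -[RHS]/(conj_id _ b) -(sch_epiK S). Qed.

Lemma sch_epi_ker (x : X) : f (k x) = 1.
Proof. exact/eqP/(ker_valP x). Qed.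

(** The Schreier retraction, extracted from its unique existence by choice. *)
Definition sch_q : sch_dom S -> X := projT1 (cid (sch_retraction S)).

Lemma sch_qE a : a = k (sch_q a) * r (f a).
Proof. by have [qP _] := projT2 (cid (sch_retraction S)); exact: qP. Qed.

(** Applying [f] determines [b], and cancelling [r b] then determines [x]. *)
Lemma sch_q_uniq a x b : a = k x * r b -> sch_q a = x /\ f a = b.
Proof.
move=> aE; have fa : f a = b.
  by rewrite aE gmulfM /= sch_epi_ker mul1g sch_epi_sec.
split=> //; apply: val_inj; apply: (@cmulIg _ (r b)).
by rewrite -[X in _ * r X]fa -sch_qE.
Qed.

Definition sch_act (b : sch_cod S) (x : X) : X := sch_q (r b * k x).

(** The commutation rule that characterizes the action; every property of the
    action below follows from it and from [sch_act_uniq]. *)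
Lemma sch_actE b x : k (sch_act b x) * r b = r b * k x.
Proof.
rewrite [RHS]sch_qE.
by rewrite gmulfM /= sch_epi_ker mulg1 sch_epi_sec.
Qed.

Lemma sch_act_uniq b x y : k y * r b = r b * k x -> sch_act b x = y.
Proof. by move/esym/sch_q_uniq => []. Qed.

Fact sch_act_mulg b : {morph sch_act b : x y / x * y}.
Proof.
move=> x y; apply: sch_act_uniq.
by rewrite !valM /= -mulgA sch_actE mulgA sch_actE mulgA.
Qed.

Fact sch_act_one b : sch_act b 1 = 1.
Proof. by apply: sch_act_uniq; rewrite val1 mulg1 mul1g. Qed.

Definition sch_act_end (b : sch_cod S) : End X :=
  HB.pack_for (UMagmaMorphism.type X X) (sch_act b)
    (isMultiplicative.Build X X (sch_act b) (sch_act_mulg b))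
    (Multiplicative_isUMagmaMorphism.Build X X (sch_act b) (sch_act_one b)).

Fact sch_act_endM : {morph sch_act_end : b c / b * c}.
Proof.
move=> b c; apply: umagma_morphism_ext => x; apply: sch_act_uniq.
by rewrite gmulfM /= mulgA sch_actE -mulgA sch_actE mulgA.
Qed.

Fact sch_act_end1 : sch_act_end 1 = 1.
Proof.
apply: umagma_morphism_ext => x; apply: sch_act_uniq.
by rewrite gmulf1 mulg1 mul1g.
Qed.

Definition sch_phi : UMagmaMorphism.type (sch_cod S) (End X) :=
  HB.pack_for (UMagmaMorphism.type (sch_cod S) (End X)) sch_act_end
    (isMultiplicative.Build (sch_cod S) (End X) sch_act_end sch_act_endM)
    (Multiplicative_isUMagmaMorphism.Build (sch_cod S) (End X) sch_act_end
       sch_act_end1).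

(** The operations of the domain in normal form [k x * r b]: they have the shape
    of those of a semidirect product. The three axioms of the action result from
    putting both sides of an axiom of conjugation monoids in normal form and
    comparing the kernel components with [sch_norm_inj]. *)
Lemma sch_norm_mul (x y : X) b c :
  k x * r b * (k y * r c) = k (x * act sch_phi b y) * r (b * c).
Proof.
by rewrite valM !gmulfM /= -!mulgA [r b * (k y * _)]mulgA -sch_actE !mulgA.
Qed.

Lemma sch_norm_bar (x : X) b :
  bar (k x * r b) = k (act sch_phi (bar b) (bar x)) * r (bar b).
Proof. by rewrite sch_actE barM conj_morph_bar. Qed.

Lemma sch_norm_inj (x y : X) b c : k x * r b = k y * r c -> x = y.
Proof. by move=> /sch_q_uniq [<- _]; case: (sch_q_uniq (erefl (k x * r b))). Qed.

Fact sch_barC b (x : X) :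
  act sch_phi (bar b) (bar x * x) = x * act sch_phi (b * bar b) (bar x).
Proof.
have := mul_barC (k x * r b); rewrite sch_norm_bar !sch_norm_mul.
by move=> /sch_norm_inj; rewrite -act_mulg -actM.
Qed.

Fact sch_barCA b1 b2 (x1 x2 : X) :
  x1 * act sch_phi (b1 * bar b1) (bar x1 * x2) =
  x2 * act sch_phi (b2 * bar b1) (bar x1 * x1).
Proof.
have := mul_barCA (k x2 * r b2) (k x1 * r b1).
rewrite sch_norm_bar !sch_norm_mul => /sch_norm_inj.
by rewrite -!actM -!mulgA -!act_mulg.
Qed.

Fact sch_barM b1 b2 (x2 : X) :
  act sch_phi (bar b2 * bar b1) (bar (act sch_phi b1 x2)) =
  act sch_phi (bar b2) (bar x2).
Proof.
(* The kernel component of the first factor would only contribute a term that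
   is common to both sides, so the first factor is taken in the section. *)
have := barM (k 1 * r b1) (k x2 * r b2).
rewrite !(sch_norm_bar, sch_norm_mul) => /sch_norm_inj.
by rewrite bar1 !act_one mulg1 mul1g barM.
Qed.

Definition sch_action : external_action :=
  ExternalAction sch_barC sch_barCA sch_barM.

(** The multiplication map comparing the semidirect product with the domain. *)
Definition sch_gather_fun (a : semidirect sch_action) : sch_dom S :=
  k (sd_obj a) * r (sd_act a).

Fact sch_gatherM : {morph sch_gather_fun : a c / a * c}.
Proof. by move=> [x b] [y c]; rewrite /sch_gather_fun sch_norm_mul. Qed.

Fact sch_gather_bar : {morph sch_gather_fun : a / bar a >-> bar a}.
Proof. by move=> [x b]; rewrite /sch_gather_fun sch_norm_bar. Qed.

Definition sch_gather : conjMorphism (semidirect sch_action) (sch_dom S) :=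
  conj_morphism_of_morphs sch_gatherM sch_gather_bar.

Lemma sch_gather_bij : bijective sch_gather.
Proof.
exists (fun a => @Semidirect sch_action (sch_q a) (f a)) => [[x b]|a] /=.
  by have [-> ->] := sch_q_uniq (erefl (k x * r b)).
exact/esym/sch_qE.
Qed.

Fact sch_gather_epi :
  conj_comp f sch_gather = conj_comp (conj_id _) (sd_epi sch_action).
Proof.
apply: conjMorphism_ext => -[x b] /=.
by have [_ ->] := sch_q_uniq (erefl (k x * r b)).
Qed.

Fact sch_gather_sec :
  conj_comp sch_gather (sd_sec sch_action) = conj_comp r (conj_id _).
Proof. by apply: conjMorphism_ext => b; exact: mul1g. Qed.

Definition sch_counit : schreier_mor (sd_schreier sch_action) S :=
  @SchreierMor (sd_schreier sch_action) S _ _ sch_gather_epi sch_gather_sec.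

End SchreierAction.

(** * The two functors *)

Section SemidirectMorphism.
Variables (P Q : external_action) (h : action_mor P Q).

Definition sd_map (a : semidirect P) : semidirect Q :=
  Semidirect (act_mor_obj h (sd_obj a)) (act_mor_act h (sd_act a)).

Fact sd_mapM : {morph sd_map : a c / a * c}.
Proof.
move=> [x b] [y c].
by rewrite /sd_map !sd_mulE /= !gmulfM /= act_mor_equivariant.
Qed.

Fact sd_map_bar : {morph sd_map : a / bar a >-> bar a}.
Proof.
move=> [x b].
by rewrite /bar /= /sd_bar /sd_map /= act_mor_equivariant !conj_morph_bar.
Qed.

Definition sd_mor_dom : conjMorphism (semidirect P) (semidirect Q) :=
  conj_morphism_of_morphs sd_mapM sd_map_bar.

Fact sd_mor_epi :
  conj_comp (sd_epi Q) sd_mor_dom = conj_comp (act_mor_act h) (sd_epi P).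
Proof. exact: conjMorphism_ext. Qed.

Fact sd_mor_sec :
  conj_comp sd_mor_dom (sd_sec P) = conj_comp (sd_sec Q) (act_mor_act h).
Proof. by apply: conjMorphism_ext => b; rewrite /= /sd_map /= gmulf1. Qed.

Definition sd_mor : schreier_mor (sd_schreier P) (sd_schreier Q) :=
  @SchreierMor (sd_schreier P) (sd_schreier Q) _ _ sd_mor_epi sd_mor_sec.

End SemidirectMorphism.

Section KernelMorphism.
Variables (S T : schreier) (h : schreier_mor S T).

Lemma sch_mor_epiE a : sch_epi T (sch_mor_dom h a) = sch_mor_cod h (sch_epi S a).
Proof. by have := congr1 (fun g : conjMorphism _ _ => g a) (sch_mor_epi h). Qed.

Lemma sch_mor_secE b : sch_mor_dom h (sch_sec S b) = sch_sec T (sch_mor_cod h b).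
Proof. by have := congr1 (fun g : conjMorphism _ _ => g b) (sch_mor_sec h). Qed.

Fact ker_map_subproof (x : kernel (sch_epi S)) :
  sch_mor_dom h (ker_val x) \in ker_pred (sch_epi T).
Proof. by rewrite inE sch_mor_epiE sch_epi_ker gmulf1. Qed.

Definition ker_map (x : kernel (sch_epi S)) := Kernel (ker_map_subproof x).

Fact ker_mapM : {morph ker_map : x y / x * y}.
Proof. by move=> x y; apply: val_inj; rewrite !valM /= !gmulfM. Qed.

Fact ker_map_bar : {morph ker_map : x / bar x >-> bar x}.
Proof. by move=> x; apply: val_inj; rewrite /= !conj_morph_bar. Qed.

Definition ker_map_mor : conjMorphism (kernel (sch_epi S)) (kernel (sch_epi T)) :=
  conj_morphism_of_morphs ker_mapM ker_map_bar.

(** By uniqueness of the action: [h] carries the commutation rule over [S] to the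
    one over [T]. *)
Fact ker_map_equivariant b x :
  ker_map_mor (act (sch_phi S) b x) =
  act (sch_phi T) (sch_mor_cod h b) (ker_map_mor x).
Proof.
apply/esym/sch_act_uniq; rewrite /= -sch_mor_secE -!gmulfM /=.
by rewrite sch_actE.
Qed.

Definition sch_action_mor : action_mor (sch_action S) (sch_action T) :=
  @ActionMor (sch_action S) (sch_action T) _ _ ker_map_equivariant.

End KernelMorphism.

Fact sd_mor_id (P : ExternalActions) : sd_mor (action_id P) = schreier_id _.
Proof. by apply: schreier_mor_ext; apply: conjMorphism_ext => // -[]. Qed.

Fact sd_mor_comp (P Q R : ExternalActions) (k : hom Q R) (h : hom P Q) :
  sd_mor (comp k h) = schreier_comp (sd_mor k) (sd_mor h).
Proof. by apply: schreier_mor_ext; apply: conjMorphism_ext. Qed.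

Definition semidirect_functor : functor ExternalActions SchreierSplitEpi :=
  @Functor ExternalActions SchreierSplitEpi sd_schreier sd_mor
    sd_mor_id sd_mor_comp.

Fact sch_action_mor_id (S : SchreierSplitEpi) :
  sch_action_mor (schreier_id S) = action_id _.
Proof.
by apply: action_mor_ext; apply: conjMorphism_ext => // x; apply: val_inj.
Qed.

Fact sch_action_mor_comp (S T U : SchreierSplitEpi) (k : hom T U)
    (h : hom S T) :
  sch_action_mor (comp k h) =
  action_comp (sch_action_mor k) (sch_action_mor h).
Proof.
by apply: action_mor_ext; apply: conjMorphism_ext => // x; apply: val_inj.
Qed.

Definition kernel_action_functor : functor SchreierSplitEpi ExternalActions :=
  @Functor SchreierSplitEpi ExternalActions sch_action sch_action_mor
    sch_action_mor_id sch_action_mor_comp.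

(** * The two natural isomorphisms *)

Section KernelOfSemidirect.
Variable P : external_action.

Lemma sd_act_ker (x : kernel (sd_epi P)) : sd_act (ker_val x) = 1.
Proof. exact/eqP/(ker_valP x). Qed.

Definition sd_proj (x : kernel (sd_epi P)) : ea_obj P := sd_obj (ker_val x).

Fact sd_projM : {morph sd_proj : x y / x * y}.
Proof. by move=> x y; rewrite /sd_proj valM /= sd_act_ker act1. Qed.

Fact sd_proj_bar : {morph sd_proj : x / bar x >-> bar x}.
Proof. by move=> x; rewrite /sd_proj /= sd_act_ker bar1 act1. Qed.

Definition sd_proj_mor : conjMorphism (kernel (sd_epi P)) (ea_obj P) :=
  conj_morphism_of_morphs sd_projM sd_proj_bar.

Lemma sd_proj_bij : bijective sd_proj_mor.
Proof.
exists (@sd_ker P) => [x|x] //; apply: val_inj.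
by rewrite /= /sd_proj; case: (ker_val x) (sd_act_ker x) => y b /= ->.
Qed.

(** In the semidirect product, [(1, b) * (x, 1) = (b . x, 1) * (1, b)], so moving
    the section past the kernel recovers the given action. *)
Fact sd_proj_equivariant b x :
  sd_proj_mor (act (sch_phi (sd_schreier P)) b x) =
  act (ea_phi P) (conj_id _ b) (sd_proj_mor x).
Proof.
rewrite (_ : act _ b x = sd_ker (act (ea_phi P) b (sd_proj x))) //.
apply: sch_act_uniq; rewrite /= /sd_proj.
case: (ker_val x) (sd_act_ker x) => y c /= ->.
by rewrite !sd_mulE act_one !mulg1 !mul1g.
Qed.

Definition sd_unit : action_mor (sch_action (sd_schreier P)) P :=
  @ActionMor (sch_action (sd_schreier P)) P _ _ sd_proj_equivariant.

End KernelOfSemidirect.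

Lemma semidirect_functorK : nat_isomorphic
  (comp_functor kernel_action_functor semidirect_functor)
  (id_functor ExternalActions).
Proof.
have nat (P Q : ExternalActions) (h : hom P Q) :
    action_comp (sd_unit Q) (sch_action_mor (sd_mor h)) =
    action_comp h (sd_unit P).
  by apply: action_mor_ext; apply: conjMorphism_ext.
exists (@NatTrans _ _ (comp_functor kernel_action_functor semidirect_functor)
  (id_functor _) sd_unit nat) => P.
by apply: action_iso; [exists id | exact: sd_proj_bij].
Qed.

Lemma kernel_action_functorK : nat_isomorphic
  (comp_functor semidirect_functor kernel_action_functor)
  (id_functor SchreierSplitEpi).
Proof.
have nat (S T : SchreierSplitEpi) (h : hom S T) :
    schreier_comp (sch_counit T) (sd_mor (sch_action_mor h)) =
    schreier_comp h (sch_counit S).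
  apply: schreier_mor_ext; apply: conjMorphism_ext => // a.
  by rewrite /= /sch_gather_fun gmulfM /= sch_mor_secE.
exists (@NatTrans _ _ (comp_functor semidirect_functor kernel_action_functor)
  (id_functor _) sch_counit nat) => S.
by apply: schreier_iso; [exact: sch_gather_bij | exists id].
Qed.

Theorem proposition5p2 :
  equivalent_categories ExternalActions SchreierSplitEpi.
Proof.
exists semidirect_functor, kernel_action_functor.
by split; [exact: semidirect_functorK | exact: kernel_action_functorK].
Qed.
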